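(* Let $\mathcal{L}=\{H_i\}_{i\in I}$ and $\mathcal{E}=\{E_j\}_{j\in J}$ be partitions of $\Omega$ ($I,J$ arbitrary), let $\mathcal{A}_{\mathcal L},\mathcal{A}_{\mathcal E},\mathcal{A}$ be Boolean algebras with $\langle\mathcal L\rangle\subseteq\mathcal A_{\mathcal L}\subseteq\langle\mathcal L\rangle^*$, $\langle\mathcal E\rangle\subseteq\mathcal A_{\mathcal E}\subseteq\langle\mathcal E\rangle^*$, $\langle\mathcal A_{\mathcal L}\cup\mathcal A_{\mathcal E}\rangle\subseteq\mathcal A\subseteq\langle\mathcal A_{\mathcal L}\cup\mathcal A_{\mathcal E}\rangle^*$. Let $\sigma$ be a strategy on $\mathcal A\times\mathcal L$ such that $\sigma(F|\cdot)$ is $\mathcal A_{\mathcal L}$-continuous for every $F\in\mathcal A$, and let $\pi$ be a finitely additive probability on $\mathcal A_{\mathcal L}$. Then the set $\mathcal Q^{\mathbf{fd}}$ of all fully $\mathcal L$-disintegrable full conditional probabilities on $\mathcal A$ extending $\{\pi,\sigma\}$ is a non-empty compact subset of $[0,1]^{\mathcal A\times\mathcal A^0}$ endowed with the product topology of pointwise convergence.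
   Context: Events are elements of a Boolean algebra with operations $\wedge,\vee,(\cdot)^c$, implication order $\subseteq$, top $\Omega$ and bottom $\emptyset$; $\mathcal A^0=\mathcal A\setminus\{\emptyset\}$, $\mathcal A_{\mathcal L}^0=\mathcal A_{\mathcal L}\setminus\{\emptyset\}$. For a set $\mathcal G$ of events, $\langle\mathcal G\rangle$ is the Boolean algebra generated by $\mathcal G$, and $\langle\mathcal G\rangle^*$ is the complete atomic Boolean algebra generated by $\mathcal G$ (the minimal atomic Boolean algebra containing $\mathcal G$ and closed under arbitrary conjunctions and disjunctions). A partition of $\Omega$ is a family of pairwise incompatible non-impossible events with disjunction $\Omega$. The atoms of $\mathcal A$ are the events $H_i\wedge E_j\neq\emptyset$. A conditional event $E|H$ is a pair of events $(E,H)$ with $H\neq\emptyset$. Strategy: a map $\sigma:\mathcal A\times\mathcal L\to[0,1]$ such that for every $H_i\in\mathcal L$: (S1) $\sigma(F|H_i)=1$ for every $F\in\mathcal A$ with $F\wedge H_i=H_i$; (S2) $\sigma(\cdot|H_i)$ is a finitely additive probability on $\mathcal A$. Full conditional probability (f.c.p.) on $\mathcal A$: a function $P:\mathcal A\times\mathcal A^0\to[0,1]$ with (C1) $P(E|H)=P(E\wedge H|H)$; (C2) $P(\cdot|H)$ is a finitely additive probability on $\mathcal A$ for every $H\in\mathcal A^0$; (C3) $P(E\wedge F|H)=P(E|H)\,P(F|E\wedge H)$ whenever $H,E\wedge H\in\mathcal A^0$, $E,F\in\mathcal A$. It extends $\{\pi,\sigma\}$ if $P(B|\Omega)=\pi(B)$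 for $B\in\mathcal A_{\mathcal L}$ and $P(F|H_i)=\sigma(F|H_i)$ for $F\in\mathcal A$, $H_i\in\mathcal L$. Integration: for bounded $X:\mathcal L\to\mathbb R$ and a finitely additive probability $\mu$ on $\mathcal A_{\mathcal L}$, the lower and upper Stieltjes integrals are $\sup\sum_{u=1}^m(\inf_{H_i\subseteq A_u}X(H_i))\mu(A_u)$ and $\inf\sum_{u=1}^m(\sup_{H_i\subseteq A_u}X(H_i))\mu(A_u)$, over finite partitions $\{A_u\}_{u=1}^m\subseteq\mathcal A_{\mathcal L}$ of $\Omega$; when equal, the common value is the Stieltjes integral $\int X(H_i)\mu(\mathrm dH_i)$. $X$ is $\mathcal A_{\mathcal L}$-continuous if it is bounded and for every $t\in\mathbb R$, $\epsilon>0$ there is $A\in\mathcal A_{\mathcal L}$ with $(X\ge t)\supseteq A\supseteq(X\ge t+\epsilon)$, where $(X\ge t)=\bigvee\{H_i\in\mathcal L: X(H_i)\ge t\}$; such $X$ is Stieltjes integrable with respect to every finitely additive probability on $\mathcal A_{\mathcal L}$. Full $\mathcal L$-disintegrability: an f.c.p. $\tilde Q$ on $\mathcal A$ extending $\{\pi,\sigma\}$ is fully $\mathcal L$-disintegrable if, with $\tilde\pi^{\mathbf p}=\tilde Q|_{\mathcal A_{\mathcal L}\times\mathcal A_{\mathcal L}^0}$, for every $F|K\in\mathcal A\times\mathcal A_{\mathcal L}^0$, $\tilde Q(F|K)=\int\sigma(F|H_i)\,\tilde\pi^{\mathbf p}(\mathrm dH_i|K)$. *)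

(* Defs.v *)
From HB Require Import structures.
From mathcomp Require Import all_boot all_order all_algebra.
From mathcomp Require Import all_classical all_reals all_analysis.

Set Implicit Arguments.
Unset Strict Implicit.
Unset Printing Implicit Defensive.

Import Order.TTheory GRing.Theory Num.Theory.
Import numFieldNormedType.Exports.

Local Open Scope classical_set_scope.
Local Open Scope ring_scope.

(* Events are elements of a Boolean algebra B,
   with operations and order in scope %O.  A Boolean algebra of events is a set
   A : set B, and A `\ \bot%O is the set of its non-impossible events.  Set
   functions and conditional set functions are total on B, and only their
   values on the stated domain are constrained or used. *)

Section Algebras.
Context {d : Order.disp_t} {B : ctbDistrLatticeType d}.
Implicit Types (S G : set B) (a x y : B).

(* Conjunctions and disjunctions of arbitrary families are infimums and supremums
   in the order of B; completeness makes them always exist. *)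
Definition complete_boolean (d' : Order.disp_t) (T : porderType d') : Prop :=
  forall D : set T, supremums D !=set0.

Record bool_subalgebra S : Prop := {
  bsub_bot : S \bot%O;
  bsub_top : S \top%O;
  bsub_compl : forall x, S x -> S (~` x)%O;
  bsub_meet : forall x y, S x -> S y -> S (x `&` y)%O;
  bsub_join : forall x y, S x -> S y -> S (x `|` y)%O }.

Definition is_atom S a : Prop :=
  [/\ S a, a <> \bot%O
    & forall x, S x -> (x <= a)%O -> x = \bot%O \/ x = a].

Record complete_atomic_subalgebra S : Prop := {
  casub_bool : bool_subalgebra S;
  casub_sup : forall (D : set B) s, D `<=` S -> supremums D s -> S s;
  casub_inf : forall (D : set B) s, D `<=` S -> infimums D s -> S s;
  casub_atomic : forall x, S x -> x <> \bot%O ->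
    exists2 a, is_atom S a & (a <= x)%O }.

Definition gen G : set B := smallest bool_subalgebra G.

Definition gen_star G : set B := smallest complete_atomic_subalgebra G.

Definition is_partition (I : Type) (H : I -> B) : Prop :=
  [/\ forall i, H i <> \bot%O,
      forall i j, i <> j -> (H i `&` H j)%O = \bot%O
    & supremums (range H) \top%O].

End Algebras.

Section Probability.
Context {R : realType} {d : Order.disp_t} {B : ctbDistrLatticeType d}.
Implicit Types (A AL : set B) (mu pi : B -> R) (P : B -> B -> R).

(* Values in [0,1] follow from nonnegativity, normalization and additivity. *)
Definition fa_probability A mu : Prop :=
  [/\ forall E, A E -> 0 <= mu E,
      mu \top%O = 1
    & forall E F, A E -> A F -> (E `&` F)%O = \bot%O ->
        mu (E `|` F)%O = mu E + mu F].

(* [sigma F i] stands for sigma(F | H_i), and [P E K] for P(E | K). *)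
Definition strategy (I : Type) A (H : I -> B) (sigma : B -> I -> R) : Prop :=
  (forall i F, A F -> (F `&` H i)%O = H i -> sigma F i = 1) /\
  (forall i, fa_probability A (fun F => sigma F i)).

Record full_cond_prob A P : Prop := {
  fcp_range : forall E K, A E -> (A `\ \bot%O) K -> 0 <= P E K <= 1;
  fcp_C1 : forall E K, A E -> (A `\ \bot%O) K -> P E K = P (E `&` K)%O K;
  fcp_C2 : forall K, (A `\ \bot%O) K -> fa_probability A (fun E => P E K);
  fcp_C3 : forall E F K, A E -> A F ->
    (A `\ \bot%O) K -> (A `\ \bot%O) (E `&` K)%O ->
    P (E `&` F)%O K = P E K * P F (E `&` K)%O }.

Definition extends_prior_strategy (I : Type) AL A (H : I -> B) pi
    (sigma : B -> I -> R) P : Prop :=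
  (forall C, AL C -> P C \top%O = pi C) /\
  (forall F i, A F -> P F (H i) = sigma F i).

Section Integral.
Context {I : Type}.
Variables (AL : set B) (H : I -> B).
Implicit Types (X : I -> R).

Definition bounded_on_partition X : Prop := exists M : R, forall i, `|X i| <= M.

Definition lower_stieltjes X mu : R :=
  sup [set r | exists (m : nat) (C : 'I_m -> B),
    [/\ is_partition C, forall u, AL (C u)
      & r = \sum_(u < m) inf [set X i | i in [set i | (H i <= C u)%O]]
                         * mu (C u)]].

Definition upper_stieltjes X mu : R :=
  inf [set r | exists (m : nat) (C : 'I_m -> B),
    [/\ is_partition C, forall u, AL (C u)
      & r = \sum_(u < m) sup [set X i | i in [set i | (H i <= C u)%O]]
                         * mu (C u)]].

Definition is_stieltjes_integral X mu (v : R) : Prop :=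
  [/\ bounded_on_partition X, lower_stieltjes X mu = v
    & upper_stieltjes X mu = v].

Definition event_ge X (t : R) : B :=
  supremum \bot%O [set H i | i in [set i | t <= X i]].

Definition AL_continuous X : Prop :=
  bounded_on_partition X /\
  forall t eps : R, 0 < eps ->
    exists2 C, AL C & (event_ge X (t + eps) <= C <= event_ge X t)%O.

End Integral.

Definition fully_disintegrable (I : Type) AL A (H : I -> B)
    (sigma : B -> I -> R) P : Prop :=
  forall F K, A F -> (AL `\ \bot%O) K ->
    is_stieltjes_integral AL H (sigma F) (fun C => P C K) (P F K).

(* The space [0,1]^(A x A^0) with the product topology, [0,1] carrying the
   topology induced by R. *)
Definition cond_space A : topologicalType :=
  {ptws (A `*` (A `\ \bot%O)) -> [set` `[0 : R, 1]]}.

(* Zero outside A x A^0. *)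
Definition cond_fun A (Q : cond_space A) : B -> B -> R :=
  fun E K => 'valL_ 0 (fun x => set_val (Q x)) (E, K).

Definition fully_disintegrable_extensions (I : Type) AL A (H : I -> B) pi
    (sigma : B -> I -> R) : set (cond_space A) :=
  [set Q | [/\ full_cond_prob A (cond_fun Q),
      extends_prior_strategy AL A H pi sigma (cond_fun Q)
    & fully_disintegrable AL A H sigma (cond_fun Q)]].

End Probability.

Arguments cond_space R {d B} A.
Arguments fully_disintegrable_extensions {R d B I} AL A H pi sigma.

(* Main.v *)
(* By the chain rule and complementation, full disintegrability of P amounts to
   conglomerability on AL: c <= P(F|K) as soon as c <= sigma(F|H_i) for all
   H_i <= K.  All the defining conditions are thereby closed for pointwise
   convergence, and compactness follows from Tychonoff's theorem.  By compactness
   again, existence only has to be established for finitely many events and up to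
   a factor 1 + eps.  There one takes P(F|K) = m(F /\ K) / m(K), where m is a
   finite combination of laws sigma(.|H_i) reproducing pi on the given events of
   AL, plus a small multiple of measures sigma(.|H_i) + eps * delta, with delta
   the point mass at an atom H_i /\ E_j, which make the given conditioning events
   non-negligible. *)
Require Import Defs.
From HB Require Import structures.
From mathcomp Require Import all_boot all_order all_algebra.
From mathcomp Require Import all_classical all_reals all_analysis.
From mathcomp Require Import ring lra.
Import Order.Theory GRing.Theory Num.Theory.
Import numFieldNormedType.Exports.

Local Open Scope classical_set_scope.
Local Open Scope ring_scope.

(** * Events that split no cell of a given family *)

Section Decided.
Context {d : Order.disp_t} {B : ctbDistrLatticeType d}.
Implicit Types (S G : set B) (x y z : B).

(** For pairwise disjoint cells covering [\top], these are exactly the joins of cells, described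
    without forming any join. *)
Definition decided {T : Type} (a : T -> B) : set B :=
  [set x | forall k, (a k <= x)%O \/ (a k `&` x)%O = \bot%O].

(** If [x] were disjoint from every [a k], its complement would be an upper bound of the family,
    hence equal to [\top]. *)
Lemma cover_meets {T : Type} (a : T -> B) x :
  supremums (range a) \top%O -> x <> \bot%O ->
  exists k, (a k `&` x)%O <> \bot%O.
Proof.
move=> [_ top_lub] x0; apply: contrapT => noK; apply: x0.
have ub : ubound (range a) (~` x)%O.
  move=> _ [k _ <-]; rewrite -disj_leC; apply/eqP.
  by apply: contrapT => ne; apply: noK; exists k.
have /= := top_lub _ ub; rewrite le1x -compl0 => /eqP /(can_inj complK).
by [].
Qed.

Lemma decided_sub {T : Type} (a : T -> B) x :
  supremums (range a) \top%O -> decided a x -> x <> \bot%O ->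
  exists2 k, a k <> \bot%O & (a k <= x)%O.
Proof.
move=> cov dx x0; have [k kx] := cover_meets a x cov x0; exists k.
  by move=> a0; apply: kx; rewrite a0 meet0x.
by case: (dx k) => // /kx.
Qed.

Lemma decidedC {T : Type} (a : T -> B) x : decided a x -> decided a (~` x)%O.
Proof.
move=> dx k; case: (dx k) => [akx|akx].
  by right; apply/eqP; rewrite disj_leC complK.
by left; rewrite -disj_leC akx.
Qed.

Lemma decidedI {T : Type} (a : T -> B) x y :
  decided a x -> decided a y -> decided a (x `&` y)%O.
Proof.
move=> dx dy k; rewrite lexI.
case: (dx k) => [->|e]; last by right; rewrite meetA e meet0x.
by case: (dy k) => [->|e]; [left|right; rewrite meetCA e meetx0].
Qed.

Lemma decidedU {T : Type} (a : T -> B) x y :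
  decided a x -> decided a y -> decided a (x `|` y)%O.
Proof.
by move=> dx dy; rewrite -[(x `|` y)%O]complK complU;
  apply/decidedC/decidedI; apply/decidedC.
Qed.

(** A cell disjoint from every member of [D] has a complement that bounds [D] from above, so it is
    disjoint from the supremum; the infimum case is dual. The atoms are the cells other than
    [\bot]. *)
Lemma decided_complete_atomic {T : Type} (a : T -> B) :
  (forall k l, a k <> a l -> (a k `&` a l)%O = \bot%O) ->
  supremums (range a) \top%O ->
  complete_atomic_subalgebra (decided a).
Proof.
move=> disj cov; split.
- split; [by move=> k; right; rewrite meetx0 | by move=> k; left; rewrite lex1
  | exact: decidedC | exact: decidedI | exact: decidedU].
- move=> D s DS [ubs lubs] k.
  have [[x Dx akx]|no] := pselect (exists2 x, D x & (a k <= x)%O).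
    by left; apply: le_trans akx (ubs _ Dx).
  right; apply/eqP; rewrite disj_leC lexC; apply: lubs => x Dx.
  rewrite lexC -disj_leC; case: (DS _ Dx k) => [akx|/eqP//].
  by exfalso; apply: no; exists x.
- move=> D s DS [lbs glbs] k.
  have [[x Dx akx]|no] := pselect (exists2 x, D x & (a k `&` x)%O = \bot%O).
    right; apply/eqP; rewrite disj_leC lexC; apply: le_trans (lbs _ Dx) _.
    by rewrite lexC -disj_leC akx.
  left; apply: glbs => x Dx; case: (DS _ Dx k) => // akx.
  by exfalso; apply: no; exists x.
- move=> x dx x0; have [k ak0 akx] := decided_sub _ _ cov dx x0.
  exists (a k) => //; split=> //.
    move=> l; have [->|ne] := pselect (a l = a k); first by left.
    by right; exact: disj.
  move=> y dy yk; case: (dy k) => [ky|].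
    by right; apply/eqP; rewrite eq_le yk.
  by rewrite meet_r // => ->; left.
Qed.

Lemma gen_star_decided {T : Type} (a : T -> B) G :
  (forall k l, a k <> a l -> (a k `&` a l)%O = \bot%O) ->
  supremums (range a) \top%O ->
  G `<=` decided a -> gen_star G `<=` decided a.
Proof.
move=> disj cov Ga; apply: smallest_sub => //.
exact: decided_complete_atomic.
Qed.

Lemma partition_decided {T : Type} (a : T -> B) :
  is_partition a -> gen_star (range a) `<=` decided a.
Proof.
move=> [a0 disj cov]; apply: gen_star_decided => //.
  by move=> k l ne; apply: disj => e; apply: ne; rewrite e.
move=> _ [l _ <-] k; have [->|ne] := pselect (k = l); first by left.
by right; exact: disj.
Qed.

Lemma decided_refine {T U : Type} (a : T -> B) (b : U -> B) :
  (forall k, exists l, (a k <= b l)%O) -> decided b `<=` decided a.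
Proof.
move=> ref x dx k; have [l kl] := ref k; case: (dx l) => [lx|lx].
  by left; exact: le_trans lx.
right; apply/eqP; rewrite disj_leC; apply: le_trans kl _.
by rewrite -disj_leC lx.
Qed.

Lemma cover_product {T U : Type} (a : T -> B) (b : U -> B) :
  supremums (range a) \top%O -> supremums (range b) \top%O ->
  supremums (range (fun p : T * U => a p.1 `&` b p.2)%O) \top%O.
Proof.
move=> cova covb; split; first by move=> x _; rewrite lex1.
move=> z zub; apply: contrapT => zne.
have z0 : (~` z)%O <> \bot%O.
  by move=> e; apply: zne; rewrite -[z]complK e compl0.
have [k kz] := cover_meets _ _ cova z0.
have [l lz] := cover_meets _ _ covb kz.
apply: lz; apply/eqP; rewrite meetA (meetC (b l)) disj_leC complK.
by apply: zub; exists (k, l).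
Qed.

(** Applied to the partitions [H] and [E], this turns the upper bound on [A] into the fact that
    every event of [A] contains or excludes each atom H_i /\ E_j. Some of the product cells may be
    impossible. *)
Lemma product_decided {T U : Type} (a : T -> B) (b : U -> B) G1 G2 :
  is_partition a -> is_partition b ->
  G1 `<=` gen_star (range a) -> G2 `<=` gen_star (range b) ->
  gen_star (G1 `|` G2) `<=` decided (fun p : T * U => a p.1 `&` b p.2)%O.
Proof.
move=> pa pb G1a G2b; apply: gen_star_decided.
- have [_ da _] := pa; have [_ db _] := pb.
  move=> [k1 l1] [k2 l2] /= ne.
  have [ek|nk] := pselect (k1 = k2).
    have [el|nl] := pselect (l1 = l2); first by rewrite ek el in ne.
    by rewrite meetACA db // meetx0.
  by rewrite meetACA da // meet0x.
- by apply: cover_product; [have [] := pa|have [] := pb].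
- move=> x [/G1a|/G2b] /partition_decided dx.
    by apply: decided_refine (dx _) => // -[k l]; exists k; exact: leIl.
  by apply: decided_refine (dx _) => // -[k l]; exists l; exact: leIr.
Qed.

End Decided.

(** * Finitely additive set functions on an algebra *)

Section Additive.
Context {R : realType} {d : Order.disp_t} {B : ctbDistrLatticeType d}.
Variables (S : set B) (mu : B -> R).
Hypothesis S_alg : bool_subalgebra S.

(** Neither sign nor normalization is imposed, so that the notion also covers unnormalized measures
    and maps such as C |-> P(F /\ C | K). *)
Definition disjoint_additive (nu : B -> R) : Prop :=
  forall x y, S x -> S y -> (x `&` y)%O = \bot%O -> nu (x `|` y)%O = nu x + nu y.

Lemma additive_bot (nu : B -> R) : disjoint_additive nu -> nu \bot%O = 0.
Proof.
move=> add; have S0 := bsub_bot S_alg.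
have := add _ _ S0 S0 (meet0x _); rewrite joinx0 => e; lra.
Qed.

Lemma additive_split (nu : B -> R) x y : disjoint_additive nu -> S x -> S y ->
  nu x = nu (x `&` y)%O + nu (x `&` ~` y)%O.
Proof.
move=> add Sx Sy; have Sy' := bsub_compl S_alg Sy.
rewrite -add; [|exact: bsub_meet..|].
- by rewrite -meetUr joinxC meetx1.
- by rewrite meetACA meetxC meetx0.
Qed.

Lemma additive_joins (nu : B -> R) (T : Type) (r : seq T) (C : T -> B) :
  disjoint_additive nu -> (forall t, S (C t)) ->
  pairwise (fun s t => C s `&` C t == \bot)%O r ->
  S (\join_(t <- r) C t)%O /\
  nu (\join_(t <- r) C t)%O = \sum_(t <- r) nu (C t).
Proof.
move=> add SC; elim: r => [|x r IH] /=.
  by move=> _; rewrite !big_nil additive_bot //; split=> //; exact: bsub_bot.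
move=> /andP[xr /IH [Sr nur]]; rewrite !big_cons -nur.
split; first exact: bsub_join.
apply: add => //; apply/eqP; rewrite disj_leC lexC.
elim: r xr {IH Sr nur} => [|y r IH] /=; first by rewrite big_nil le0x.
by move=> /andP[xy xr]; rewrite big_cons leUx lexC -disj_leC xy IH.
Qed.

Lemma additive_mono (nu : B -> R) x y :
  (forall z, S z -> 0 <= nu z) -> disjoint_additive nu ->
  S x -> S y -> (x <= y)%O -> nu x <= nu y.
Proof.
move=> nu0 add Sx Sy xy.
rewrite (additive_split _ _ _ add Sy Sx) (meet_r xy) lerDl nu0 //.
by apply: (bsub_meet S_alg Sy); exact: (bsub_compl S_alg).
Qed.

Hypothesis mu_prob : fa_probability S mu.

Lemma fa_additive : disjoint_additive mu. Proof. by case: mu_prob. Qed.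

Lemma fa_bot : mu \bot%O = 0.
Proof. exact: additive_bot fa_additive. Qed.

Lemma fa_compl x : S x -> mu (~` x)%O = 1 - mu x.
Proof.
move=> Sx; have [_ mu1 _] := mu_prob.
have := additive_split _ _ _ fa_additive (bsub_top S_alg) Sx.
by rewrite !meet1x mu1 => ->; ring.
Qed.

Lemma fa_le1 x : S x -> mu x <= 1.
Proof.
move=> Sx; have [mu0 <- add] := mu_prob.
by apply: additive_mono => //; exact: (bsub_top S_alg).
Qed.

End Additive.

(** * Finite partitions *)

Section Partitions.
Context {d : Order.disp_t} {B : ctbDistrLatticeType d}.

Lemma partition_joins m (C : 'I_m -> B) :
  is_partition C -> (\join_(u < m) C u)%O = \top%O.
Proof.
case=> _ _ [_ lub]; apply/eqP; rewrite -le1x; apply: lub => _ [u _ <-].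
exact: joins_sup.
Qed.

Lemma partition_pairwise m (C : 'I_m -> B) : is_partition C ->
  pairwise (fun s t => C s `&` C t == \bot)%O (index_enum 'I_m).
Proof.
case=> _ disj _; have := index_enum_uniq 'I_m; rewrite uniq_pairwise.
by apply: sub_pairwise => s t /= st; apply/eqP/disj/eqP.
Qed.

(** Stieltjes sums run over partitions without impossible cells, whereas lists obtained by cutting
    may contain [\bot]. Discarding it preserves the sum of any [f] that vanishes at [\bot]. *)
Lemma seq_partition (S : set B) (s : seq B) :
  (forall x, x \in s -> S x) ->
  pairwise (fun x y => x `&` y == \bot)%O s -> (\join_(x <- s) x)%O = \top%O ->
  exists m (C : 'I_m -> B), [/\ is_partition C, forall u, S (C u),
    forall u, C u \in s
    & forall (R : realType) (f : B -> R), f \bot%O = 0 ->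
      \sum_(u < m) f (C u) = \sum_(x <- s) f x].
Proof.
move=> sS sdisj sjoin; set s' := [seq x <- s | x != \bot%O].
have s'disj : pairwise (fun x y => x `&` y == \bot)%O s'.
  exact: pairwise_filter.
have mem_s' (u : 'I_(size s')) :
    (tnth (in_tuple s') u != \bot%O) && (tnth (in_tuple s') u \in s).
  by have := mem_tnth u (in_tuple s'); rewrite mem_filter.
exists (size s'), (tnth (in_tuple s')); split.
- split=> [u|u v|].
  + by apply/eqP; have /andP[] := mem_s' u.
  + move=> /eqP; rewrite -val_eqE /= neq_ltn !(tnth_nth \bot%O) /=.
    have /(pairwiseP \bot%O) dj := s'disj.
    by case/orP => uv; [|rewrite meetC]; apply/eqP/dj => //;
      rewrite inE ltn_ord.
  + split; first by move=> x _; exact: lex1.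
    move=> z ubz; rewrite -sjoin; apply/joinsP_seq => x xs _.
    have [->|x0] := eqVneq x \bot%O; first exact: le0x.
    have xs' : x \in s' by rewrite mem_filter x0.
    have /tnthP[u ->] : x \in in_tuple s' by [].
    by apply: ubz; exists u.
- by move=> u; have /andP[_ /sS] := mem_s' u.
- by move=> u; have /andP[] := mem_s' u.
- move=> R f f0; rewrite -(big_tnth _ _ s' xpredT f) big_filter.
  rewrite [RHS](bigID (fun x => x != \bot%O)) /= [X in _ = _ + X]big1 ?addr0 //.
  by move=> x; rewrite negbK => /eqP ->.
Qed.

End Partitions.

(** * Stieltjes integrals of continuous integrands *)

Section Stieltjes.
Context {R : realType} {d : Order.disp_t} {B : ctbDistrLatticeType d}.
Context {I : Type}.
Variables (AL : set B) (H : I -> B) (X : I -> R).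
Hypothesis B_complete : complete_boolean B.
Hypothesis AL_alg : bool_subalgebra AL.
Hypothesis partH : is_partition H.
Hypothesis AL_decided : AL `<=` decided H.

(** If [X i < t], then [H i] is disjoint from every member of the family, so the supremum lies below
    the complement of [H i] and cannot contain [H i]. *)
Lemma le_event_ge t i : t <= X i <-> (H i <= event_ge H X t)%O.
Proof.
rewrite /event_ge /supremum; set D := [set H i | i in _].
have [H0 disj _] := partH.
split=> [ti|].
  have Di : D (H i) by exists i.
  (* [supremum] takes its default [\bot] on an empty family and otherwise chooses a least upper
     bound, which exists by completeness. *)
  case: ifPn => [/eqP D0|_]; first by rewrite D0 in Di.
  case: xgetP => [s _ [ub _]|no]; first exact: ub.
  by have [y /no] := B_complete D.
case: ifPn => [_|_].
  by rewrite lex0 => /eqP /H0.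
case: xgetP => [s _ [ub lub] Hi|no _]; last by have [y /no] := B_complete D.
rewrite leNgt; apply/negP => ti.
have : (s <= ~` (H i))%O.
  apply: lub => _ [j tj <-]; rewrite -disj_leC; apply/eqP/disj => e.
  by move: ti; rewrite -e ltNge tj.
move=> /(le_trans Hi); rewrite -disj_leC meetxx => /eqP.
exact: H0.
Qed.

Hypothesis X_cont : AL_continuous AL H X.

(* Induction on the width n of the range of X on D, in units of delta: an event C
   between (X >= t + delta) and (X >= t) cuts off a top cell of width 2 delta. *)
Lemma small_oscillation (delta : R) (n : nat) (t0 : R) D : 0 < delta -> AL D ->
  (forall i, (H i <= D)%O -> t0 <= X i < t0 + delta *+ n) ->
  exists s : seq B, [/\ forall x, x \in s -> AL x,
    pairwise (fun x y => x `&` y == \bot)%O s, (\join_(x <- s) x)%O = D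
    & forall x, x \in s -> forall i j, (H i <= x)%O -> (H j <= x)%O ->
      X i <= X j + delta *+ 2].
Proof.
move=> delta0; elim: n D => [|n IH] D ALD DX.
  (* For [n = 0] the half-open range is empty, so no [H i] lies below [D] and the oscillation bound
     is vacuous. *)
  exists [:: D]; split=> [x|//||x]; rewrite ?inE ?big_seq1//.
    by move=> /eqP ->.
  move=> /eqP -> i j /DX /andP[/le_lt_trans /[apply]].
  by rewrite mulr0n addr0 ltxx.
(* The range ends at [t + delta *+ 2]. On [C] the values lie in its upper two units; off [C] they
   stay below [t + delta], the end of the range in the induction hypothesis. *)
set t := t0 + delta *+ n - delta.
have [_ /(_ t delta delta0) [C ALC /andP[geC Cge]]] := X_cont.
have ALC' := bsub_compl AL_alg ALC.
have inC i : (H i <= C)%O -> t <= X i.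
  by move=> HC; apply/le_event_ge; apply: le_trans Cge.
have outC i : (H i <= ~` C)%O -> X i < t0 + delta *+ n.
  move=> HC; rewrite ltNge; apply/negP => ge.
  have HiC : (H i <= C)%O.
    by apply: le_trans geC; apply/le_event_ge; rewrite /t subrK.
  have [H0 _ _] := partH; apply: (H0 i); apply/eqP; rewrite -lex0.
  by rewrite -(meetxC C) lexI HiC.
have [|i|s [sAL sdisj sjoin sosc]] := IH (D `&` ~` C)%O.
- exact: bsub_meet.
- rewrite lexI => /andP[/DX /andP[-> _] /outC ->] //.
exists ((D `&` C)%O :: s); split.
- move=> x; rewrite inE => /orP[/eqP ->|/sAL//]; exact: bsub_meet.
- rewrite /= sdisj andbT; apply/allP => x xs.
  have xD : (x <= D `&` ~` C)%O by rewrite -sjoin; exact: joins_sup_seq.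
  rewrite disj_leC lexC; apply: le_trans xD _.
  by rewrite complI; exact: le_trans (leIr _ _) (leUr _ _).
- by rewrite big_cons sjoin -meetUr joinxC meetx1.
- move=> x; rewrite inE => /orP[/eqP ->|/sosc//] i j.
  rewrite !lexI => /andP[/DX /andP[_ iD] _] /andP[_ /inC jC].
  rewrite mulrS in iD; rewrite mulr2n; rewrite /t in jC; lra.
Qed.

Variables (mu nu : B -> R).
Hypothesis X01 : forall i, 0 <= X i <= 1.
Hypothesis mu_prob : fa_probability AL mu.
Hypothesis nu_add : disjoint_additive AL nu.
Hypothesis nu_lower : forall C c, AL C ->
  (forall i, (H i <= C)%O -> c <= X i) -> c * mu C <= nu C.
Hypothesis nu_upper : forall C c, AL C ->
  (forall i, (H i <= C)%O -> X i <= c) -> nu C <= c * mu C.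

Let values C := [set X i | i in [set i | (H i <= C)%O]].

Lemma values_lb C : lbound (values C) 0.
Proof. by move=> _ [i _ <-]; have /andP[] := X01 i. Qed.

Lemma values_ub C : ubound (values C) 1.
Proof. by move=> _ [i _ <-]; have /andP[] := X01 i. Qed.

Lemma sum_partition (f : B -> R) m (C : 'I_m -> B) :
  disjoint_additive AL f -> is_partition C -> (forall u, AL (C u)) ->
  \sum_(u < m) f (C u) = f \top%O.
Proof.
move=> fadd pC ALC; rewrite -(partition_joins _ _ pC).
by have [] := additive_joins _ AL_alg _ _ _ _ fadd ALC (partition_pairwise _ _ pC).
Qed.

(** Meant for [mu] = P(. | K) and [nu] = P(F /\ . | K). The cell bounds place the total mass of [nu]
    between all lower and all upper sums, and continuity of [X] makes their gap arbitrarily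
    small. *)
Lemma stieltjes_integral_intro : is_stieltjes_integral AL H X mu (nu \top%O).
Proof.
rewrite /is_stieltjes_integral /lower_stieltjes /upper_stieltjes.
set L := [set r | _]; set U := [set r | _].
have L_le : ubound L (nu \top%O).
  move=> _ [m [C [pC ALC ->]]].
  rewrite -(sum_partition _ _ _ nu_add pC ALC); apply: ler_sum => u _.
  apply: nu_lower => // i HiC; apply: ge_inf; last by exists i.
  by exists 0; exact: values_lb.
have U_ge : lbound U (nu \top%O).
  move=> _ [m [C [pC ALC ->]]].
  rewrite -(sum_partition _ _ _ nu_add pC ALC); apply: ler_sum => u _.
  apply: nu_upper => // i HiC; apply: ub_le_sup; last by exists i.
  by exists 1; exact: values_ub.
(* Cells on which [X] oscillates by at most [e], weighted by a [mu] of total mass 1, give sums at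
   distance at most [e]. The number [n] of steps [e / 2] is large enough to cover [[0, 1]]. *)
have close e : 0 < e -> exists l u, [/\ L l, U u & u <= l + e].
  move=> e0; pose n := Num.bound (e / 2)^-1.
  have e20 : 0 < e / 2 by rewrite divr_gt0.
  have nP : 1 < (e / 2) *+ n.
    rewrite -mulr_natr -ltr_pdivrMl // mulr1 archi_boundP //.
    by rewrite invr_ge0 ltW.
  have [||i _|s [sAL sdisj sjoin sosc]] := @small_oscillation (e / 2) n 0 \top%O.
  - exact: e20.
  - exact: bsub_top.
  - by have /andP[-> /le_lt_trans->] := X01 i; rewrite ?add0r.
  have [m [C [pC ALC Cs _]]] := seq_partition _ _ sAL sdisj sjoin.
  exists (\sum_(u < m) inf (values (C u)) * mu (C u)),
         (\sum_(u < m) sup (values (C u)) * mu (C u)).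
  split; [by exists m, C|by exists m, C|].
  have [_ mu1 _] := mu_prob.
  have -> : e = \sum_(u < m) e * mu (C u).
    rewrite -mulr_sumr (sum_partition _ _ _ (fa_additive _ _ mu_prob)) //.
    by rewrite mu1 mulr1.
  rewrite -big_split /=; apply: ler_sum => u _; rewrite -mulrDl.
  have [mu0 _ _] := mu_prob; apply: ler_wpM2r; first exact: mu0.
  (* Each cell contains some [H k], so [inf] and [sup] are taken over non-empty sets rather than at
     their default value. *)
  have [C0 _ _] := pC; have [_ _ covH] := partH.
  have [k _ kC] := decided_sub H _ covH (AL_decided _ (ALC u)) (C0 u).
  have ne : values (C u) !=set0 by exists (X k), k.
  apply: ge_sup => // _ [i iC <-]; rewrite -lerBlDr.
  apply: lb_le_inf => // _ [j jC <-]; rewrite lerBlDr.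
  by have := sosc _ (Cs u) _ _ iC jC; rewrite mulr2n -splitr.
have [l0 [u0 [Ll0 Uu0 _]]] := close 1 ltr01.
split; first by case: X_cont.
- apply/le_anti/andP; split; first by apply: ge_sup => //; exists l0.
  apply/ler_addgt0Pr => e /close [l [u [Ll Uu ule]]].
  apply: le_trans (U_ge _ Uu) _; apply: le_trans ule _; rewrite lerD2r.
  by apply: ub_le_sup => //; exists (nu \top%O).
- apply/le_anti/andP; split; last by apply: lb_le_inf => //; exists u0.
  apply/ler_addgt0Pr => e /close [l [u [Ll Uu ule]]].
  apply: (@le_trans _ _ u); last by apply: le_trans ule _; rewrite lerD2r L_le.
  by apply: ge_inf => //; exists (nu \top%O).
Qed.

End Stieltjes.

(** * Equivalence of full disintegrability and conglomerability *)

Section Conglomerability.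
Context {R : realType} {d : Order.disp_t} {B : ctbDistrLatticeType d}.
Context {I : Type}.
Variables (AL A : set B) (H : I -> B) (sigma : B -> I -> R).
Hypothesis AL_alg : bool_subalgebra AL.
Hypothesis A_alg : bool_subalgebra A.
Hypothesis AL_A : AL `<=` A.
Hypothesis partH : is_partition H.
Hypothesis AL_decided : AL `<=` decided H.
Hypothesis AL_H : forall i, AL (H i).
Hypothesis sigma_strat : strategy A H sigma.

Definition conglomerable (P : B -> B -> R) : Prop :=
  forall F K c, A F -> (AL `\ \bot%O) K ->
    (forall i, (H i <= K)%O -> c <= sigma F i) -> c <= P F K.

Lemma strategy01 F i : A F -> 0 <= sigma F i <= 1.
Proof.
move=> AF; have [_ /(_ i) sp] := sigma_strat.
rewrite (fa_le1 _ _ A_alg sp _ AF) andbT.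
by have [s0 _ _] := sp; exact: s0.
Qed.

Variable P : B -> B -> R.
Hypothesis P_fcp : full_cond_prob A P.

Lemma ALbot_A K : (AL `\ \bot%O) K -> (A `\ \bot%O) K.
Proof. by case=> /AL_A. Qed.

Lemma fcp_self K : (A `\ \bot%O) K -> P K K = 1.
Proof.
move=> AK; have [_ P1 _] := fcp_C2 P_fcp AK.
by rewrite -P1 (fcp_C1 P_fcp (bsub_top A_alg) AK) meet1x.
Qed.

Lemma fa_subset (S S' : set B) (mu : B -> R) :
  S `<=` S' -> fa_probability S' mu -> fa_probability S mu.
Proof.
move=> SS' [mu0 mu1 mu_add]; split=> // [x /SS'|x y /SS' Sx /SS' Sy].
  exact: mu0.
exact: mu_add.
Qed.

(** Since P(K | K) = 1, the lower sum over the partition of [\top] into [K] and its complement is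
    the infimum of [sigma F] over [K], and the integral dominates it. *)
Lemma fully_disintegrable_conglomerable :
  fully_disintegrable AL A H sigma P -> conglomerable P.
Proof.
move=> fd F K c AF ALK cK.
have AK := ALbot_A _ ALK; have [K1 K0] := ALK.
have PK := fa_subset _ _ _ AL_A (fcp_C2 P_fcp AK).
have [_ _ covH] := partH.
have [_ <- _] := fd F K AF ALK.
have ALK' := bsub_compl AL_alg K1.
pose f x := inf [set sigma F i | i in [set i | (H i <= x)%O]] * P x K.
have f0 : f \bot%O = 0 by rewrite /f (fa_bot _ _ AL_alg PK) mulr0.
have [|||m [C [pC ALC _ Csum]]] := @seq_partition _ _ AL [:: K; ~` K]%O.
- by move=> x; rewrite !inE => /orP[]/eqP->.
- by rewrite /= meetxC eqxx.
- by rewrite !big_cons big_nil joinx0 joinxC.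
have [k _ kK] := decided_sub H _ covH (AL_decided _ K1) K0.
apply: (@le_trans _ _ (f K)).
  rewrite /f fcp_self // mulr1; apply: lb_le_inf; first by exists (sigma F k), k.
  by move=> _ [i iK <-]; exact: cK.
apply: ub_le_sup; last first.
  exists m, C; split=> //; rewrite -/(f _) (Csum _ f f0) !big_cons big_nil.
  by rewrite /f (fa_compl _ _ AL_alg PK) // fcp_self // subrr mulr0 !addr0.
(* Lower sums are at most 1; without such a bound their supremum need not dominate them. *)
exists 1 => _ [n [D [pD ALD ->]]].
have [PK0 PK1 _] := PK.
rewrite -PK1 -(sum_partition _ AL_alg _ _ _ (fa_additive _ _ PK) pD ALD).
apply: ler_sum => u _; rewrite -[leRHS]mul1r; apply: ler_wpM2r; first exact: PK0.
have [D0 _ _] := pD.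
have [l _ lD] := decided_sub H _ covH (AL_decided _ (ALD u)) (D0 u).
apply: (@le_trans _ _ (sigma F l)); last by have /andP[] := strategy01 F l AF.
apply: ge_inf; last by exists l.
by exists 0 => _ [i _ <-]; have /andP[] := strategy01 F i AF.
Qed.

Hypothesis P_cong : conglomerable P.

Lemma sigmaC F i : A F -> sigma (~` F)%O i = 1 - sigma F i.
Proof. by move=> AF; have [_ /(_ i) /fa_compl ->] := sigma_strat. Qed.

Lemma conglomerable_upper F K c : A F -> (AL `\ \bot%O) K ->
  (forall i, (H i <= K)%O -> sigma F i <= c) -> P F K <= c.
Proof.
move=> AF ALK Kc; rewrite -lerN2 -(lerD2l 1).
rewrite -(fa_compl _ _ A_alg (fcp_C2 P_fcp (ALbot_A _ ALK)) _ AF).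
apply: P_cong => // [|i /Kc]; first exact: bsub_compl.
by rewrite sigmaC // lerD2l lerN2.
Qed.

(** [H i] is the only cell below itself, so the lower and the upper bound on P(F | H_i) are both
    [sigma F i]. Agreement with the strategy thus comes for free. *)
Lemma conglomerable_strategy F i : A F -> P F (H i) = sigma F i.
Proof.
move=> AF; have [H0 disj _] := partH.
have Hi j : (H j <= H i)%O -> j = i.
  move=> ji; apply: contrapT => /disj; rewrite (meet_l ji); exact: H0.
have ALH0 : (AL `\ \bot%O) (H i) by split; [exact: AL_H|exact: H0].
apply/le_anti/andP; split.
  by apply: conglomerable_upper => // j /Hi ->.
by apply: P_cong => // j /Hi ->.
Qed.

Lemma fcp_chain F C K : A F -> AL C -> (AL `\ \bot%O) K ->
  (C `&` K)%O <> \bot%O -> P (F `&` C)%O K = P C K * P F (C `&` K)%O.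
Proof.
move=> AF ALC ALK CK0; rewrite meetC.
apply: (fcp_C3 P_fcp) => //; [exact: AL_A|exact: ALbot_A|].
split=> //; apply: AL_A; apply: (bsub_meet AL_alg) => //; by case: ALK.
Qed.

Lemma fcp_disjoint F C K : A F -> AL C -> (AL `\ \bot%O) K ->
  (C `&` K)%O = \bot%O -> P (F `&` C)%O K = 0.
Proof.
move=> AF ALC ALK CK0; have AK := ALbot_A _ ALK.
rewrite (fcp_C1 P_fcp) //; last by apply: bsub_meet => //; exact: AL_A.
by rewrite -meetA CK0 meetx0 (fa_bot _ _ A_alg (fcp_C2 P_fcp AK)).
Qed.

(** By the chain rule P(F /\ C | K) = P(C | K) P(F | C /\ K), and conglomerability at C /\ K bounds
    the second factor. When C /\ K is impossible, both sides of the cell bounds vanish. *)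
Lemma conglomerable_fully_disintegrable :
  complete_boolean B ->
  (forall F, A F -> AL_continuous AL H (sigma F)) ->
  fully_disintegrable AL A H sigma P.
Proof.
move=> B_complete sigma_cont F K AF ALK; have AK := ALbot_A _ ALK.
have PK := fcp_C2 P_fcp AK.
have AFC C : AL C -> A (F `&` C)%O.
  by move=> ALC; apply: bsub_meet => //; exact: AL_A.
have topE C : AL C -> P C K = P (\top `&` C)%O K by rewrite meet1x.
(* Writing [F] as its meet with [\top] presents P(F | K) as the total mass of C |-> P(F /\ C |
   K). *)
rewrite -[X in is_stieltjes_integral _ _ _ _ (P X K)]meetx1.
have [PK0 _ PKadd] := PK.
apply: (@stieltjes_integral_intro _ _ _ _ AL H (sigma F) B_complete AL_alg partH
  AL_decided (sigma_cont F AF) (P^~ K) (fun C => P (F `&` C)%O K)).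
- by move=> i; exact: strategy01.
- exact: fa_subset PK.
- move=> C D ALC ALD CD; rewrite meetUr; apply: PKadd; [exact: AFC..|].
  by rewrite meetACA CD meetx0.
- move=> C c ALC cC; have [CK0|CK0] := pselect ((C `&` K)%O = \bot%O).
    rewrite (topE C ALC) !fcp_disjoint ?mulr0 //; exact: bsub_top.
  rewrite fcp_chain // mulrC ler_wpM2l //; first by apply: PK0; exact: AL_A.
  apply: P_cong => //; first by split=> //; apply: bsub_meet => //; case: ALK.
  by move=> i; rewrite lexI => /andP[/cC].
- move=> C c ALC cC; have [CK0|CK0] := pselect ((C `&` K)%O = \bot%O).
    rewrite (topE C ALC) !fcp_disjoint ?mulr0 //; exact: bsub_top.
  rewrite fcp_chain // (mulrC c) ler_wpM2l //; first by apply: PK0; exact: AL_A.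
  apply: conglomerable_upper => //.
    by split=> //; apply: bsub_meet => //; case: ALK.
  by move=> i; rewrite lexI => /andP[/cC].
Qed.

End Conglomerability.

(** * Near-conglomerable measures *)

Section Approximation.
Context {R : realType} {d : Order.disp_t} {B : ctbDistrLatticeType d}.
Context {I J : Type}.
Variables (AL A : set B) (H : I -> B) (E : J -> B) (sigma : B -> I -> R).
Hypothesis AL_alg : bool_subalgebra AL.
Hypothesis A_alg : bool_subalgebra A.
Hypothesis AL_A : AL `<=` A.
Hypothesis partH : is_partition H.
Hypothesis AL_decided : AL `<=` decided H.
Hypothesis cover_HE :
  supremums (range (fun p : I * J => H p.1 `&` E p.2)%O) \top%O.
Hypothesis A_decided : A `<=` decided (fun p : I * J => H p.1 `&` E p.2)%O.
Hypothesis sigma_strat : strategy A H sigma.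

Lemma sigma_sub F i : A F -> (H i <= F)%O -> sigma F i = 1.
Proof. by move=> AF HF; apply: (sigma_strat.1) => //; rewrite meet_r. Qed.

Lemma sigma_disjoint F i : A F -> (H i `&` F)%O = \bot%O -> sigma F i = 0.
Proof.
move=> AF HF; have := sigmaC _ _ _ A_alg sigma_strat F i AF.
rewrite sigma_sub; [lra|exact: bsub_compl|by rewrite -disj_leC HF].
Qed.

Lemma sigma_meet F K i : A F -> A K -> (H i <= K)%O ->
  sigma (F `&` K)%O i = sigma F i.
Proof.
move=> AF AK HK; have [_ /(_ i) sp] := sigma_strat.
have AK' := bsub_compl A_alg AK.
rewrite (additive_split _ A_alg _ F K (fa_additive _ _ sp)) //.
rewrite [X in _ = _ + X]sigma_disjoint ?addr0 //; first exact: bsub_meet.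
by apply/eqP; rewrite disj_leC complI complK lexU2 // HK orbT.
Qed.

(** Dividing by [m K] gives conglomerability of m(F /\ K) / m(K) up to the factor [1 + eps]. The
    undivided form is stable under sums and non-negative multiples of [m], and makes sense when
    [m K = 0]. *)
Definition near_conglomerable (eps : R) (m : B -> R) : Prop :=
  [/\ forall F, A F -> 0 <= m F, disjoint_additive A m
    & forall K F c, AL K -> A F -> 0 <= c ->
        (forall i, (H i <= K)%O -> c <= sigma F i) ->
        c * m K <= (1 + eps) * m (F `&` K)%O].

Variable eps : R.
Hypothesis eps0 : 0 < eps.

Let eps_ge0 : 0 <= eps. Proof. exact: ltW. Qed.
Let eps1_ge0 : 0 <= 1 + eps. Proof. exact: addr_ge0. Qed.

Lemma near_conglomerable0 : near_conglomerable eps (fun=> 0).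
Proof. by split=> // [x y _ _ _|K F c _ _ _ _]; rewrite ?addr0 ?mulr0. Qed.

Lemma near_conglomerableD m1 m2 : near_conglomerable eps m1 ->
  near_conglomerable eps m2 -> near_conglomerable eps (fun F => m1 F + m2 F).
Proof.
move=> [m10 m1a m1c] [m20 m2a m2c]; split.
- by move=> F AF; rewrite addr_ge0 ?m10 ?m20.
- by move=> x y Sx Sy xy; rewrite m1a // m2a // addrACA.
- move=> K F c ALK AF c0 Kc; rewrite !mulrDr lerD //.
    exact: m1c.
  exact: m2c.
Qed.

Lemma near_conglomerableZ a m : 0 <= a -> near_conglomerable eps m ->
  near_conglomerable eps (fun F => a * m F).
Proof.
move=> a0 [m0 ma mc]; split.
- by move=> F AF; rewrite mulr_ge0 ?m0.
- by move=> x y Sx Sy xy; rewrite ma // mulrDr.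
- move=> K F c ALK AF c0 Kc; rewrite !(mulrCA _ a) ler_wpM2l //.
  exact: mc.
Qed.

(** If [H i] lies in [K], then [sigma K i = 1] and the bound follows from the hypothesis at [i];
    otherwise [sigma K i = 0]. *)
Lemma near_conglomerable_sigma i : near_conglomerable eps (sigma^~ i).
Proof.
have [_ /(_ i) sp] := sigma_strat.
have [sp0 _ spa] := sp; split=> // K F c ALK AF c0 Kc.
have AK := AL_A _ ALK.
case: (AL_decided _ ALK i) => HK.
  rewrite sigma_meet // (sigma_sub K) // mulr1.
  have s0 : 0 <= sigma F i := sp0 _ AF.
  have := Kc _ HK; have := mulr_ge0 eps_ge0 s0; lra.
rewrite (sigma_disjoint K) // mulr0 mulr_ge0 ?sp0 //.
exact: bsub_meet.
Qed.

(* A point mass at an atom H_i /\ E_j <= K makes K non-negligible; alone it would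
   violate conglomerability, but next to sigma(. | H_i) it costs only a factor
   1 + eps. *)
Lemma near_conglomerable_positive K : A K -> K <> \bot%O ->
  exists2 m, near_conglomerable eps m & 0 < m K.
Proof.
move=> AK K0.
have [[i j] /= a0 aK] := decided_sub _ _ cover_HE (A_decided _ AK) K0.
set a := (H i `&` E j)%O in a0 aK.
have [sp0 spa spc] := near_conglomerable_sigma i.
pose delta F : R := ((a <= F)%O)%:R.
have delta0 F : 0 <= delta F by exact: ler0n.
exists (fun F => sigma F i + eps * delta F); last first.
  by rewrite /delta aK mulr1 ltr_wpDl // sp0.
split.
- by move=> F AF; rewrite addr_ge0 ?sp0 // mulr_ge0.
- move=> x y Ax Ay xy; rewrite spa // addrACA -mulrDr; congr (_ + eps * _).
  have disj : ~ ((a <= x)%O /\ (a <= y)%O).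
    move=> [ax ay]; apply: a0; apply/eqP; rewrite -lex0 -xy lexI ax.
    by [].
  rewrite /delta -natrD; congr (_%:R).
  case: (A_decided _ Ax (i, j)) => /= ax.
    rewrite ax (le_trans ax (leUl _ _)); have [ay|_ //] := boolP (a <= y)%O.
    by exfalso; apply: disj.
  case: (A_decided _ Ay (i, j)) => /= ay.
    rewrite ay (le_trans ay (leUr _ _)); have [ax'|_ //] := boolP (a <= x)%O.
    by exfalso; apply: disj.
  have no z : (a `&` z)%O = \bot%O -> (a <= z)%O = false.
    by move=> az; apply/negP => /meet_l az'; apply: a0; rewrite -az' az.
  by rewrite !no // meetUr ax ay joinx0.
- move=> L F c ALL AF c0 Lc; have AL' := AL_A _ ALL.
  case: (AL_decided _ ALL i) => HL.
    rewrite sigma_meet // (sigma_sub L) // /delta (le_trans (leIl _ _) HL).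
    have -> : (a <= F `&` L)%O = (a <= F)%O.
      by rewrite lexI (le_trans (leIl _ _) HL) andbT.
    (* Here [L] has mass [1 + eps], and the factor [1 + eps] on the right pays for the point mass
       even when [F] misses the atom. *)
    rewrite mulr1 mulrC ler_wpM2l // (le_trans (Lc _ HL)) // lerDl.
    exact: mulr_ge0.
  have -> : delta L = 0.
    rewrite /delta; have [aL|//] := boolP (a <= L)%O; exfalso; apply: a0.
    by apply/eqP; rewrite -lex0 -HL lexI leIl aL.
  rewrite (sigma_disjoint L) // mulr0 addr0 mulr0.
  have AFL : A (F `&` L)%O by exact: bsub_meet.
  by rewrite mulr_ge0 // addr_ge0 ?sp0 ?mulr_ge0.
Qed.

Lemma near_conglomerable_positive_seq (s : seq B) :
  exists2 m, near_conglomerable eps m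
    & forall K, K \in s -> (A `\ \bot%O) K -> 0 < m K.
Proof.
elim: s => [|K s [m mc ms]]; first by exists (fun=> 0) => //; exact: near_conglomerable0.
have [[AK K0]|nAK] := pselect ((A `\ \bot%O) K); last first.
  by exists m => // L; rewrite inE => /orP[/eqP -> //|]; exact: ms.
have [m' m'c m'K] := near_conglomerable_positive _ AK K0.
exists (fun F => m' F + m F); first exact: near_conglomerableD.
move=> L; rewrite inE; have [-> _ _|_ /= Ls AL0] := eqVneq L K.
  by rewrite ltr_wpDr //; case: mc => + _ _; exact.
by rewrite ltr_wpDl //; [case: m'c => + _ _; apply; case: AL0|exact: ms].
Qed.

Lemma near_conglomerable_mono m x y : near_conglomerable eps m ->
  A x -> A y -> (x <= y)%O -> m x <= m y.
Proof. by move=> [m0 ma _]; exact: additive_mono. Qed.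

Variable pi : B -> R.
Hypothesis pi_prob : fa_probability AL pi.

(* Splitting D along each event of s in turn ends with cells on which every
   event of s is constant, whose mass can be carried by any H_i inside. *)
Lemma near_conglomerable_prior (s : seq B) D : AL D ->
  exists m, [/\ near_conglomerable eps m, m \top%O = pi D, m (~` D)%O = 0
    & forall C, C \in s -> AL C -> m C = pi (C `&` D)%O].
Proof.
have piadd := fa_additive _ _ pi_prob.
elim: s D => [|C s IH] D ALD.
  have [->|D0] := pselect (D = \bot%O).
    exists (fun=> 0); split=> //; first exact: near_conglomerable0.
    by rewrite (fa_bot _ _ AL_alg pi_prob).
  have [_ _ covH] := partH.
  have [i _ iD] := decided_sub _ _ covH (AL_decided _ ALD) D0.
  have [pi0 _ _] := pi_prob.
  exists (fun F => pi D * sigma F i); split=> //.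
  - apply: near_conglomerableZ; first exact: pi0.
    exact: near_conglomerable_sigma.
  - by rewrite sigma_sub ?mulr1 ?lex1 //; exact: bsub_top.
  - rewrite sigma_disjoint ?mulr0 //.
      by apply: bsub_compl => //; exact: AL_A.
    by apply/eqP; rewrite disj_leC complK.
have [ALC|nALC] := pselect (AL C); last first.
  have [m [mc mT mD ms]] := IH D ALD; exists m; split=> // C'.
  by rewrite inE => /orP[/eqP->//|]; exact: ms.
have ALC' := bsub_compl AL_alg ALC.
have AC := AL_A _ ALC.
have ALDC := bsub_meet AL_alg ALD ALC.
have ALDC' := bsub_meet AL_alg ALD ALC'.
have [m1 [m1c m1T m1D m1s]] := IH _ ALDC.
have [m2 [m2c m2T m2D m2s]] := IH _ ALDC'.
have null m x y : near_conglomerable eps m -> m (~` x)%O = 0 -> AL x -> AL y ->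
    (y <= ~` x)%O -> m y = 0.
  move=> mc mx ALx ALy yx; apply/eqP; rewrite eq_le -{1}mx.
  have [m0 _ _] := mc; rewrite m0 ?andbT; last exact: AL_A.
  apply: near_conglomerable_mono mc _ _ yx; apply: AL_A => //.
  exact: bsub_compl.
exists (fun F => m1 F + m2 F); split.
- exact: near_conglomerableD.
- by rewrite m1T m2T -(additive_split AL AL_alg).
- have ALD' := bsub_compl AL_alg ALD.
  by rewrite (null m1 _ _ m1c m1D) ?(null m2 _ _ m2c m2D) ?addr0 // leC leIl.
- move=> C'; rewrite inE => /orP[/eqP -> _|C's ALC2]; last first.
    rewrite m1s // m2s // !meetA -(additive_split AL AL_alg) //.
    exact: bsub_meet.
  (* [m2] is carried by the part of [D] outside [C] and gives [C] no mass; [m1] is carried by the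
     part inside, so all of its mass lies in [C]. *)
  rewrite (null m2 _ _ m2c m2D) ?addr0 //; last first.
    by rewrite complI complK lexUr.
  rewrite meetC -m1T; have [_ m1a _] := m1c.
  rewrite (additive_split _ A_alg m1 \top%O C m1a (bsub_top A_alg) AC) !meet1x.
  rewrite (null m1 _ (~` C)%O m1c m1D) ?addr0 //.
  by rewrite leC leIr.
Qed.

(** A measure that reproduces [pi] on [s] is added to a small multiple of one that is positive on
    the possible events of [s]. The added total mass is at most [eps], which costs only the factor
    [1 + eps] in the prior. *)
Lemma near_conglomerable_approx (s : seq B) :
  exists m, [/\ near_conglomerable eps m,
    forall K, K \in s -> (A `\ \bot%O) K -> 0 < m K
    & forall C, C \in s -> AL C -> pi C * m \top%O <= (1 + eps) * m C].
Proof.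
have ALT := bsub_top AL_alg; have AT := bsub_top A_alg.
have [m1 [m1c m1T _ m1s]] := near_conglomerable_prior s _ ALT.
have [m2 m2c m2s] := near_conglomerable_positive_seq s.
have [pi0 pi1 _] := pi_prob.
have [m10 _ _] := m1c; have [m20 _ _] := m2c.
have y0 : 0 < 1 + m2 \top%O by rewrite ltr_pwDl // m20.
(* This keeps the mass of [eta * m2] below [eps]; the summand 1 makes the denominator positive in
   all cases. *)
pose eta := eps / (1 + m2 \top%O).
have eta0 : 0 < eta by rewrite divr_gt0.
have etaT : eta * m2 \top%O <= eps.
  rewrite /eta mulrAC ler_pdivrMr // ler_pM2l // lerDr.
  by [].
exists (fun F => m1 F + eta * m2 F); split.
- apply: near_conglomerableD => //; apply: near_conglomerableZ => //.
  exact: ltW.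
- move=> K Ks AK; apply: ltr_wpDl; first by apply: m10; case: AK.
  by rewrite mulr_gt0 // m2s.
- move=> C Cs ALC; rewrite m1T pi1 m1s // meetx1.
  have := pi0 _ ALC; have := mulr_ge0 (ltW eta0) (m20 _ (AL_A _ ALC)).
  move: etaT eps0; set x := eta * _; set y := eta * _ => etaT e0 y1 p0.
  have : pi C * (1 + x) <= pi C * (1 + eps) by rewrite ler_wpM2l // lerD2l.
  nra.
Qed.

(* Zero when m K = 0. *)
Definition cond_ratio (m : B -> R) (F K : B) : R := m (F `&` K)%O / m K.

Lemma cond_ratio01 m F K : near_conglomerable eps m -> A F -> A K ->
  0 <= cond_ratio m F K <= 1.
Proof.
move=> mc AF AK; have [m0 _ _] := mc.
have AFK := bsub_meet A_alg AF AK.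
rewrite /cond_ratio divr_ge0 ?m0 //=.
have [->|mK0] := eqVneq (m K) 0; first by rewrite invr0 mulr0.
rewrite ler_pdivrMr ?mul1r; last by rewrite lt0r mK0 m0.
by apply: near_conglomerable_mono => //; exact: leIr.
Qed.

Lemma cond_ratio_C1 m F K : cond_ratio m F K = cond_ratio m (F `&` K)%O K.
Proof. by rewrite /cond_ratio -meetA meetxx. Qed.

Lemma cond_ratio_additive m K : near_conglomerable eps m -> A K ->
  disjoint_additive A (cond_ratio m ^~ K).
Proof.
move=> [_ ma _] AK F G AF AG FG; rewrite /cond_ratio -mulrDl meetUl ma //.
- exact: bsub_meet.
- exact: bsub_meet.
- by rewrite meetACA FG meet0x.
Qed.

(** The chain rule survives the default value at null events: if [m] vanishes at F /\ K, then by
    monotonicity it vanishes at G /\ F /\ K, and both sides are zero. *)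
Lemma cond_ratio_C3 m F G K : near_conglomerable eps m -> A F -> A G -> A K ->
  cond_ratio m (F `&` G)%O K = cond_ratio m F K * cond_ratio m G (F `&` K)%O.
Proof.
move=> mc AF AG AK; have [m0 _ _] := mc.
have AFK := bsub_meet A_alg AF AK.
have AGFK := bsub_meet A_alg AG AFK.
rewrite /cond_ratio -meetA (meetCA F G K).
have [z|nz] := eqVneq (m (F `&` K)%O) 0; last by rewrite [RHS]mulrC mulrA divfK.
rewrite z mul0r mul0r; have -> : m (G `&` (F `&` K))%O = 0; last by rewrite mul0r.
apply/eqP; rewrite eq_le m0 // andbT -z.
by apply: near_conglomerable_mono => //; exact: leIr.
Qed.

End Approximation.

(** * Compact subtypes and closed conditions *)

Lemma compact_set_type (T : topologicalType) (D : set T) :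
  compact D -> compact [set: D].
Proof.
move=> cD F FF _.
have FD : (set_val @ F) D.
  by apply: (@filterS _ F _ setT); [move=> x _; exact: set_valP|exact: filterT].
(* The image filter clusters at a point of [D], which lifts because open sets of the subtype are
   traces of open sets of [T]. *)
have [p [Dp clp]] := cD _ (fmap_proper_filter _ FF) FD.
exists (exist _ p (mem_set Dp)); split=> // V W FV [W' [[U oU <-] Up UW]].
have FV' : F ((set_val : D -> T) @^-1` ((set_val : D -> T) @` V)).
  by apply: filterS FV; exact: preimage_image.
have [_ [[x Vx <-] Ux]] := clp _ _ FV' (open_nbhs_nbhs (conj oU Up)).
by exists x; split=> //; exact: UW.
Qed.

Lemma continuous_funD (R : realType) (T : topologicalType) (f g : T -> R) :
  continuous f -> continuous g -> continuous (fun x => f x + g x).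
Proof. by move=> cf cg x; apply: continuousD; [exact: cf|exact: cg]. Qed.

Lemma continuous_funM (R : realType) (T : topologicalType) (f g : T -> R) :
  continuous f -> continuous g -> continuous (fun x => f x * g x).
Proof. by move=> cf cg x; apply: continuousM; [exact: cf|exact: cg]. Qed.

Lemma closed_le_continuous (R : realType) (T : topologicalType) (f g : T -> R) :
  continuous f -> continuous g -> closed [set x | f x <= g x].
Proof.
move=> cf cg.
have -> : [set x | f x <= g x] = (fun x => g x - f x) @^-1` [set y | 0 <= y].
  by apply/seteqP; split=> x /=; rewrite subr_ge0.
by apply: preimage_closed (@closed_ge _ 0) => x _; apply: continuousB;
  [exact: cg|exact: cf].
Qed.

Lemma closed_eq_continuous (R : realType) (T : topologicalType) (f g : T -> R) :
  continuous f -> continuous g -> closed [set x | f x = g x].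
Proof.
move=> cf cg.
have -> : [set x | f x = g x] = [set x | f x <= g x] `&` [set x | g x <= f x].
  apply/seteqP; split=> x /= => [->|[fg gf]]; first by rewrite lexx.
  by apply/le_anti; rewrite fg.
by apply: closedI; exact: closed_le_continuous.
Qed.

Lemma closed_forall (T : topologicalType) (V : Type) (C : V -> set T) :
  (forall v, closed (C v)) -> closed [set x | forall v, C v x].
Proof.
move=> cC; have -> : [set x | forall v, C v x] = \bigcap_v C v.
  by apply/seteqP; split=> x /= Cx v; [move=> _; exact: Cx|exact: Cx].
by apply: closed_bigI => v _; exact: cC.
Qed.

Lemma closed_imply (T : topologicalType) (Q : Prop) (C : set T) :
  closed C -> closed [set x | Q -> C x].
Proof.
move=> cC; have [q|nq] := pselect Q.
  by have -> : [set x | Q -> C x] = C by apply/seteqP; split=> x /= => [/(_ q)|].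
have -> : [set x | Q -> C x] = setT; last exact: closedT.
by apply/seteqP; split=> x //= _ /nq.
Qed.

(** * The product space of conditional set functions *)

Section CondSpace.
Context {R : realType} {d : Order.disp_t} {B : ctbDistrLatticeType d}.
Variable A : set B.

Lemma cond_space_compact : compact [set: cond_space R A].
Proof.
have c : forall _ : A `*` (A `\ \bot%O), compact [set: [set` `[0 : R, 1]]].
  by move=> _; apply: compact_set_type; exact: segment_compact.
have := @tychonoff _ _ (fun=> setT) c.
have -> // : [set f | forall i, [set: [set` `[0 : R, 1]]] (f i)] = 
  [set: cond_space R A].
exact/seteqP.
Qed.

Lemma cond_funE (Q : cond_space R A) F K (FK : (F, K) \in A `*` (A `\ \bot%O)) :
  cond_fun Q F K = set_val (Q (exist _ (F, K) FK)).
Proof. by rewrite /cond_fun /= oinv_set_val insubT. Qed.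

Lemma cond_fun_out (Q : cond_space R A) F K :
  ~ (A `*` (A `\ \bot%O)) (F, K) -> cond_fun Q F K = 0.
Proof.
by move=> nFK; rewrite /cond_fun /= oinv_set_val insubF //; apply: memNset.
Qed.

(** On the domain this is a coordinate projection followed by the inclusion of the unit interval;
    elsewhere it is constantly zero. *)
Lemma cond_fun_continuous F K :
  continuous (fun Q : cond_space R A => cond_fun Q F K).
Proof.
have [/mem_set FK|nFK] := pselect ((A `*` (A `\ \bot%O)) (F, K)); last first.
  have -> : (fun Q : cond_space R A => cond_fun Q F K) = cst 0.
    by apply/funext => Q; exact: cond_fun_out.
  exact: cst_continuous.
have -> : (fun Q : cond_space R A => cond_fun Q F K) =
    set_val \o (fun Q : cond_space R A => Q (exist _ (F, K) FK)).
  by apply/funext => Q; exact: cond_funE.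
move=> Q; apply: continuous_comp; first exact: proj_continuous.
exact: initial_continuous.
Qed.

Lemma cond_fun01 (Q : cond_space R A) F K : 0 <= cond_fun Q F K <= 1.
Proof.
have [/mem_set FK|nFK] := pselect ((A `*` (A `\ \bot%O)) (F, K)); last first.
  by rewrite cond_fun_out // lexx ler01.
rewrite (cond_funE Q F K FK).
by have := set_valP (Q (exist _ (F, K) FK)); rewrite /= in_itv.
Qed.

Lemma cond_fun_surj (P : B -> B -> R) :
  (forall F K, A F -> (A `\ \bot%O) K -> 0 <= P F K <= 1) ->
  exists Q : cond_space R A, forall F K, A F -> (A `\ \bot%O) K ->
    cond_fun Q F K = P F K.
Proof.
move=> P01.
have P01' (x : A `*` (A `\ \bot%O)) :
    P (set_val x).1 (set_val x).2 \in [set` `[0 : R, 1]].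
  by apply/mem_set; rewrite /= in_itv /=; have [] := set_valP x; exact: P01.
exists (fun x => exist (fun y => y \in [set` `[0 : R, 1]]) _ (P01' x)) => F K AF AK.
have FK : (F, K) \in A `*` (A `\ \bot%O) by apply/mem_set.
by rewrite (cond_funE _ F K FK).
Qed.

End CondSpace.

(** * Existence and closedness of conglomerable extensions *)

Section Existence.
Context {R : realType} {d : Order.disp_t} {B : ctbDistrLatticeType d}.
Context {I J : Type}.
Variables (AL A : set B) (H : I -> B) (E : J -> B) (sigma : B -> I -> R).
Hypothesis AL_alg : bool_subalgebra AL.
Hypothesis A_alg : bool_subalgebra A.
Hypothesis AL_A : AL `<=` A.
Hypothesis partH : is_partition H.
Hypothesis AL_decided : AL `<=` decided H.
Hypothesis cover_HE :
  supremums (range (fun p : I * J => H p.1 `&` E p.2)%O) \top%O.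
Hypothesis A_decided : A `<=` decided (fun p : I * J => H p.1 `&` E p.2)%O.
Hypothesis sigma_strat : strategy A H sigma.
Variable pi : B -> R.
Hypothesis pi_prob : fa_probability AL pi.

Let A0 := A `\ \bot%O.
Let top_neq_bot : (\top%O : B) <> \bot%O.
Proof.
move=> e; have [_ pi1 _] := pi_prob; move: pi1.
by rewrite e (fa_bot _ _ AL_alg pi_prob) => /eqP; rewrite eq_sym oner_eq0.
Qed.
Let A0_top : A0 \top%O. Proof. by split => //; exact: (bsub_top A_alg). Qed.

(** The ratios m(F /\ K) / m(K) satisfy the first three clauses exactly, but are normalized only
    where [m K] is positive, hence the list [s]. The prior is bounded on one side only;
    complementation restores equality in the limit. *)
Record approx_solution (s : seq B) (eps : R) (P : B -> B -> R) : Prop := {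
  approx_C1 : forall F K, A F -> A0 K -> P F K = P (F `&` K)%O K;
  approx_additive : forall K, A0 K -> disjoint_additive A (P ^~ K);
  approx_C3 : forall F G K, A F -> A G -> A0 K -> A0 (F `&` K)%O ->
    P (F `&` G)%O K = P F K * P G (F `&` K)%O;
  approx_top : forall K, K \in s -> A0 K -> P \top%O K = 1;
  approx_prior : forall C, C \in s -> AL C -> pi C <= (1 + eps) * P C \top%O;
  approx_conglomerable : forall F K c, K \in s -> A F -> (AL `\ \bot%O) K ->
    0 <= c -> (forall i, (H i <= K)%O -> c <= sigma F i) ->
    c <= (1 + eps) * P F K }.

Lemma approx_solution_exists s eps : 0 < eps ->
  exists Q : cond_space R A, approx_solution s eps (cond_fun Q).
Proof.
move=> eps0.
(* Including [\top] in the list makes the total mass positive, as the division in the prior clause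
   requires. *)
have [m [mc ms mpi]] := near_conglomerable_approx AL A H E sigma AL_alg A_alg
  AL_A partH AL_decided cover_HE A_decided sigma_strat eps eps0 pi pi_prob
  (\top%O :: s).
have [m0 _ mcg] := mc.
have mT : 0 < m \top%O by apply: ms => //; rewrite inE eqxx.
have pos K : K \in s -> A0 K -> 0 < m K.
  by move=> Ks; apply: ms; rewrite inE Ks orbT.
have [F K AF [AK _]|Q QE] := cond_fun_surj A (cond_ratio m).
  exact: (cond_ratio01 AL A H sigma A_alg eps).
have AI F K : A F -> A0 K -> A (F `&` K)%O.
  by move=> AF [AK _]; exact: bsub_meet.
exists Q; split.
- move=> F K AF AK; rewrite !QE //; last exact: AI.
  exact: cond_ratio_C1.
- move=> K AK F G AF AG FG; rewrite !QE //; last exact: bsub_join.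
  have [AK1 _] := AK.
  exact: (cond_ratio_additive AL A H sigma A_alg eps m K mc).
- move=> F G K AF AG AK AFK; rewrite !QE //; last exact: bsub_meet.
  have [AK1 _] := AK.
  exact: (cond_ratio_C3 AL A H sigma A_alg eps).
- move=> K Ks AK; rewrite QE //; last exact: bsub_top.
  by rewrite /cond_ratio meet1x divff // gt_eqF // pos.
- move=> C Cs ALC; rewrite QE //; last exact: AL_A.
  rewrite /cond_ratio meetx1 mulrA ler_pdivlMr //.
  by apply: mpi => //; rewrite inE Cs orbT.
- move=> F K c Ks AF [ALK K0] c0 Kc.
  have AK : A0 K by split=> //; exact: AL_A.
  rewrite QE // /cond_ratio mulrA ler_pdivlMr ?pos //.
  exact: mcg.
Qed.

Let space := cond_space R A.
Let approx_set (p : seq B * R) : set space :=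
  [set Q | approx_solution p.1 p.2 (cond_fun Q)].
(** Two base sets both contain the one for the concatenated list and the smaller tolerance, so this
    is a filter; it is proper because every finite problem is solvable. *)
Let approx_filter : set_system space :=
  filter_from [set p : seq B * R | 0 < p.2] approx_set.

Lemma approx_solutionW s s' eps eps' P :
  {subset s <= s'} -> eps' <= eps -> (forall F K, 0 <= P F K) ->
  approx_solution s' eps' P -> approx_solution s eps P.
Proof.
move=> ss' ee' P0 [h1 h2 h3 h4 h5 h6].
have W F K : (1 + eps') * P F K <= (1 + eps) * P F K.
  by rewrite ler_wpM2r // lerD2l.
split=> //.
- by move=> K /ss'; exact: h4.
- by move=> C /ss' Cs ALC; apply: le_trans (W _ _); exact: h5.
- move=> F K c /ss' Ks AF ALK c0 Kc; apply: le_trans (W _ _).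
  exact: h6.
Qed.

Let approx_filter_proper : ProperFilter approx_filter.
Proof.
apply: filter_from_proper; last first.
  move=> [s eps] /= eps0; have [Q hQ] := approx_solution_exists s eps eps0.
  by exists Q.
apply: filter_from_filter; first by exists ([::], 1); rewrite /= ltr01.
move=> [s e] [s' e'] /= e0 e0'; exists (s ++ s', Num.min e e') => /=.
  by rewrite lt_min e0.
have P0 (Q : space) F K : 0 <= cond_fun Q F K by have /andP[] := cond_fun01 A Q F K.
move=> Q hQ; split; apply: (approx_solutionW _ _ _ _ _ _ _ (P0 Q) hQ).
- by move=> x xs; rewrite mem_cat xs.
- by rewrite ge_min lexx.
- by move=> x xs; rewrite mem_cat xs orbT.
- by rewrite ge_min lexx orbT.
Qed.

Lemma conglomerable_extension_exists : exists Q : cond_space R A,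
  [/\ full_cond_prob A (cond_fun Q), forall C, AL C -> cond_fun Q C \top%O = pi C
    & conglomerable AL A H sigma (cond_fun Q)].
Proof.
have [Q [_ clQ]] := cond_space_compact A approx_filter approx_filter_proper
  (@filterT _ _ approx_filter_proper).
(* A cluster point belongs to every closed set that contains a base set. *)
have lim s eps (C : set space) : closed C -> 0 < eps ->
    (forall Q' : space, approx_solution s eps (cond_fun Q') -> C Q') -> C Q.
  move=> cC eps0 hC; move: clQ; rewrite clusterE => /(_ C).
  rewrite -(closure_id C).1 //; apply.
  by exists (s, eps).
(* Exact clauses hold at every tolerance, so the choice of 1 is immaterial. *)
have lim_eq s (f g : space -> R) : continuous f -> continuous g ->
    (forall Q', approx_solution s 1 (cond_fun Q') -> f Q' = g Q') -> f Q = g Q.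
  by move=> cf cg; apply: lim ltr01; exact: closed_eq_continuous.
have cont F K := cond_fun_continuous A F K (R := R).
have Q01 F K := cond_fun01 A Q F K.
(* Since the values are at most 1, the factor [1 + e] costs at most [e], and [e] is arbitrary. *)
have lim_le s F K (c : R) :
    (forall eps (Q' : space), 0 < eps -> approx_solution s eps (cond_fun Q') ->
       c <= (1 + eps) * cond_fun Q' F K) -> c <= cond_fun Q F K.
  move=> hc; apply/ler_addgt0Pr => e e0; have /andP[x0 x1] := Q01 F K.
  apply: (@le_trans _ _ ((1 + e) * cond_fun Q F K)); last first.
    by rewrite mulrDl mul1r lerD2l -[leRHS]mulr1 ler_wpM2l // ltW.
  apply: (lim s e [set Q' : space | c <= (1 + e) * cond_fun Q' F K] _ e0).
    apply: closed_le_continuous; first exact: cst_continuous.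
    apply: continuous_funM (cont _ _); exact: cst_continuous.
  by move=> Q'; exact: hc.
have C1 F K : A F -> A0 K -> cond_fun Q F K = cond_fun Q (F `&` K)%O K.
  move=> AF AK; apply: (lim_eq [::] _ _ (cont _ _) (cont _ _)) => Q'.
  by case=> + _ _ _ _ _; exact.
have add K : A0 K -> disjoint_additive A (cond_fun Q ^~ K).
  move=> AK F G AF AG FG.
  apply: (lim_eq [::] _ (fun Q' => cond_fun Q' F K + cond_fun Q' G K) (cont _ _)).
    exact: continuous_funD.
  by move=> Q' [_ + _ _ _ _]; exact.
have top1 K : A0 K -> cond_fun Q \top%O K = 1.
  move=> AK; apply: (lim_eq [:: K] _ (fun=> 1) (cont _ _)).
    exact: cst_continuous.
  by move=> Q' [_ _ _ + _ _]; apply; rewrite ?inE.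
have fcp : full_cond_prob A (cond_fun Q).
  split=> //.
  - move=> K AK; split; [by move=> F _; have /andP[] := Q01 F K|exact: top1|].
    exact: add.
  - move=> F G K AF AG AK AFK; apply: (lim_eq [::] _
      (fun Q' => cond_fun Q' F K * cond_fun Q' G (F `&` K)%O) (cont _ _)).
      exact: continuous_funM.
    by move=> Q' [_ _ + _ _ _]; exact.
have prior_le C : AL C -> pi C <= cond_fun Q C \top%O.
  move=> ALC; apply: (lim_le [:: C]) => eps Q' _ [_ _ _ _ + _].
  by apply; rewrite ?inE.
exists Q; split=> //.
(* Both set functions are probabilities on [AL], so the inequality at the complement of [C] is the
   reverse inequality at [C]. *)
- move=> C ALC; apply/le_anti; rewrite prior_le // andbT.
  have := prior_le _ (bsub_compl AL_alg ALC).
  rewrite (fa_compl _ _ AL_alg pi_prob) //.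
  rewrite (fa_compl _ _ A_alg (fcp_C2 fcp A0_top)); last exact: AL_A.
  by rewrite lerD2l lerN2.
- move=> F K c AF ALK Kc.
  (* The approximate clause covers only non-negative [c]; for negative [c] the bound holds because
     values are non-negative. *)
  have [c0|c0] := leP 0 c; last first.
    by apply: le_trans (ltW c0) _; have /andP[] := Q01 F K.
  apply: (lim_le [:: K]) => eps Q' _ [_ _ _ _ _ +].
  by apply; rewrite ?inE.
Qed.

(** Bounds in [[0, 1]] hold throughout the space; each remaining condition is an equality or
    inequality between continuous expressions in finitely many evaluations. *)
Lemma closed_conglomerable_extensions : closed
  [set Q : cond_space R A |
    [/\ full_cond_prob A (cond_fun Q), forall C, AL C -> cond_fun Q C \top%O = pi C
      & conglomerable AL A H sigma (cond_fun Q)]].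
Proof.
have cont F K := cond_fun_continuous A F K (R := R).
set S := [set Q | _].
have -> : S =
    [set Q : space | forall F K, A F -> A0 K ->
       cond_fun Q F K = cond_fun Q (F `&` K)%O K] `&`
    [set Q : space | forall K, A0 K -> cond_fun Q \top%O K = 1] `&`
    [set Q : space | forall K F G, A0 K -> A F -> A G -> (F `&` G)%O = \bot%O ->
       cond_fun Q (F `|` G)%O K = cond_fun Q F K + cond_fun Q G K] `&`
    [set Q : space | forall F G K, A F -> A G -> A0 K -> A0 (F `&` K)%O ->
       cond_fun Q (F `&` G)%O K = cond_fun Q F K * cond_fun Q G (F `&` K)%O] `&`
    [set Q : space | forall C, AL C -> cond_fun Q C \top%O = pi C] `&`
    [set Q : space | conglomerable AL A H sigma (cond_fun Q)].
  apply/seteqP; split=> Q.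
    move=> [[h1 h2 h3 h4] h5 h6]; do !split=> //.
      by move=> K /h3[].
    by move=> K F G /h3[_ _]; exact.
  move=> [[[[[h2 h3] h3'] h4] h5] h6]; split=> //; split=> //.
    by move=> F K _ _; exact: cond_fun01.
  move=> K AK; split; [|exact: h3|by move=> F G; exact: h3'].
  by move=> F _; have /andP[] := cond_fun01 A Q F K.
do !apply: closedI.
- do 2![apply: closed_forall => ?]; do 2!apply: closed_imply.
  exact: closed_eq_continuous.
- apply: closed_forall => ?; apply: closed_imply.
  by apply: closed_eq_continuous => //; exact: cst_continuous.
- do 3![apply: closed_forall => ?]; do 4!apply: closed_imply.
  by apply: closed_eq_continuous => //; exact: continuous_funD.
- do 3![apply: closed_forall => ?]; do 4!apply: closed_imply.
  by apply: closed_eq_continuous => //; exact: continuous_funM.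
- apply: closed_forall => ?; apply: closed_imply.
  by apply: closed_eq_continuous => //; exact: cst_continuous.
- do 3![apply: closed_forall => ?]; do 3!apply: closed_imply.
  by apply: closed_le_continuous => //; exact: cst_continuous.
Qed.

End Existence.

(** * Non-emptiness and compactness of the set of fully disintegrable extensions *)

Theorem theorem5 (R : realType) (d : Order.disp_t) (B : ctbDistrLatticeType d)
    (B_complete : complete_boolean B)
    (I J : Type) (H : I -> B) (E : J -> B)
    (partH : is_partition H) (partE : is_partition E)
    (AL AE A : set B)
    (AL_alg : bool_subalgebra AL) (AE_alg : bool_subalgebra AE)
    (A_alg : bool_subalgebra A)
    (AL_ge : gen (range H) `<=` AL) (AL_le : AL `<=` gen_star (range H))
    (AE_ge : gen (range E) `<=` AE) (AE_le : AE `<=` gen_star (range E))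
    (A_ge : gen (AL `|` AE) `<=` A) (A_le : A `<=` gen_star (AL `|` AE))
    (sigma : B -> I -> R) (sigma_strat : strategy A H sigma)
    (sigma_cont : forall F : B, A F -> AL_continuous AL H (sigma F))
    (pi : B -> R) (pi_prob : fa_probability AL pi) :
  fully_disintegrable_extensions AL A H pi sigma !=set0 /\
  compact (fully_disintegrable_extensions AL A H pi sigma).
Proof.
have AL_A : AL `<=` A 
  by apply: subset_trans A_ge => x ALx; apply: sub_gen_smallest; left.
have AL_H i : AL (H i) by apply: AL_ge; apply: sub_gen_smallest; exists i.
have AL_decided : AL `<=` decided H.
  by apply: subset_trans AL_le _; exact: partition_decided.
have cover_HE : supremums (range (fun p : I * J => H p.1 `&` E p.2)%O) \top%O.
  by apply: cover_product; [have [] := partH|have [] := partE].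
have A_decided : A `<=` decided (fun p : I * J => H p.1 `&` E p.2)%O.
  by apply: subset_trans A_le _; exact: product_decided.
(* Trading the integral identities for conglomerability, which also forces agreement with [sigma],
   leaves only pointwise closed conditions. *)
have -> : fully_disintegrable_extensions AL A H pi sigma =
    [set Q | [/\ full_cond_prob A (cond_fun Q),
      forall C, AL C -> cond_fun Q C \top%O = pi C
      & conglomerable AL A H sigma (cond_fun Q)]].
  apply/seteqP; split=> Q.
    move=> [fcp [Qpi _] fd]; split=> //.
    exact: fully_disintegrable_conglomerable.
  move=> [fcp Qpi cg]; split=> //.
    by split=> // F i AF; apply: (conglomerable_strategy AL A H sigma).
  exact: conglomerable_fully_disintegrable.
split.
  exact: (conglomerable_extension_exists AL A H E).
apply: subclosed_compact (cond_space_compact A) _ => //.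
exact: closed_conglomerable_extensions.
Qed.
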